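(* Let $n\ge1$, $\nu\ge0$, $\alpha\in\mathbb{R}\setminus\pi\mathbb{Z}$, and let $\psi$ be a wavelet with $\psi\in L^1(\mathbb{R}^n)$. For any $a\in\mathbb{R}^n_{0}$, the operator $L^{1,\nu}_{M}(\mathbb{R}^n)\rightarrow L^{1,\nu}_{M}(\mathbb{R}^n)$ defined by $f\mapsto (W_{\psi,\alpha}f)(\cdot,a)$ is bounded. Furthermore, for all $f\in L^{1,\nu}_{M}(\mathbb{R}^n)$, $$\|(W_{\psi,\alpha}f)(\cdot,a)\|_{L^{1,\nu}_{M}(\mathbb{R}^n)}\leq\sqrt{|a|_{p}}\,\|\psi\|_{L^1(\mathbb{R}^n)}\|f\|_{L^{1,\nu}_{M}(\mathbb{R}^n)}.$$
   Context: For $x\in\mathbb{R}^n$: $\|x\|$ is the Euclidean norm, $|x|_p=|x_1x_2\cdots x_n|$, $\mathbb{R}_0^n=\{x\in\mathbb{R}^n:|x|_p\ne 0\}$; for $y\in\mathbb{R}^n_0$, $\frac{x}{y}=(x_1/y_1,\dots,x_n/y_n)$. $B(x,r)$ is the ball of center $x$ and radius $r$. The Morrey space is $L^{1,\nu}_{M}(\mathbb{R}^n)=\{f\in L^1(\mathbb{R}^n):\|f\|_{L^{1,\nu}_M(\mathbb{R}^n)}<\infty\}$, where $\|f\|_{L^{1,\nu}_{M}(\mathbb{R}^n)}=\sup_{x\in\mathbb{R}^n,r>0}\frac{1}{r^{\nu}}\int_{B(x,r)}|f(t)|\,dt$. For $a\in\mathbb{R}^n_0$, $b\in\mathbb{R}^n$: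 $\psi_{a,b,\alpha}(t)=\frac{1}{\sqrt{|a|_p}}\psi\left(\frac{t-b}{a}\right)e^{-\frac{i}{2}(\|t\|^2-\|b\|^2)\cot\alpha}$. A non-zero $\psi\in L^2(\mathbb{R}^n)$ is a wavelet if $\int_{\mathbb{R}_0^n}\int_{\mathbb{R}^n}|\langle\psi_{a,b,\alpha},\psi\rangle_{L^2(\mathbb{R}^n)}|^2\frac{db\,da}{|a|_p^2}<\infty$. The continuous fractional wavelet transform of a measurable $f$ with respect to $\psi$ is $(W_{\psi,\alpha}f)(b,a)=\int_{\mathbb{R}^n}f(t)\overline{\psi_{a,b,\alpha}(t)}\,dt$, wherever the integral exists (for fixed $a$ and the functions considered here, it exists for almost every $b$). *)

(* Defs.v *)
From HB Require Import structures.
From mathcomp Require Import all_boot all_order all_algebra.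
From mathcomp Require Import complex.
From mathcomp Require Import all_classical all_reals all_analysis.

Set Implicit Arguments.
Unset Strict Implicit.
Unset Printing Implicit Defensive.

Import Order.TTheory GRing.Theory Num.Theory.
Import numFieldNormedType.Exports.

Local Open Scope classical_set_scope.
Local Open Scope ring_scope.
Local Open Scope complex_scope.

(* R^n is n.-tuple R, whose library sigma-algebra (for the Borel sigma-algebra
   measurableTypeR R) is the product, i.e. Borel, one.  product_step mu is the
   product of the Lebesgue measure on R and of mu, carried over to
   n.+1.-tuple R. *)
Section product_step.
Context (R : realType) (n : nat).
Variable mu :
  {sigma_finite_measure set (n.-tuple (measurableTypeR R)) -> \bar R}.

Definition tcons (p : measurableTypeR R * n.-tuple (measurableTypeR R)) :
  n.+1.-tuple (measurableTypeR R) :=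
  [the n.+1.-tuple _ of p.1 :: p.2].

Lemma measurable_tcons : measurable_fun [set: _] tcons.
Proof. exact: measurable_cons. Qed.

Definition product_step : set (n.+1.-tuple (measurableTypeR R)) -> \bar R :=
  pushforward (lebesgue_measure \x mu)%E tcons.

Let product_step0 : product_step set0 = 0%E.
Proof. by rewrite /product_step /pushforward preimage_set0 measure0. Qed.

Let mtcons A : measurable A -> measurable (tcons @^-1` A).
Proof.
by move=> mA; rewrite -[X in measurable X]setTI; exact: measurable_tcons.
Qed.

Let product_step_ge0 A : (0 <= product_step A)%E.
Proof. exact: (measure_ge0 (lebesgue_measure \x mu)%E). Qed.

Let product_step_sigma_additive : semi_sigma_additive product_step.
Proof.
move=> F mF tF mUF; rewrite /product_step /pushforward preimage_bigcup.
apply: (@measure_semi_sigma_additive _ _ _ (lebesgue_measure \x mu)%E).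
- by move=> k; exact: mtcons.
- apply/trivIsetP => /= i j _ _ ij; rewrite -preimage_setI.
  by move/trivIsetP : tF => /(_ _ _ _ _ ij) ->//; rewrite preimage_set0.
- by rewrite -preimage_bigcup; exact: mtcons.
Qed.

HB.instance Definition _ := isMeasure.Build _ _ _ product_step
  product_step0 product_step_ge0 product_step_sigma_additive.

Let product_step_sigma_finite : sigma_finite setT product_step.
Proof.
have [F UF mF] : sigma_finite setT (lebesgue_measure \x mu)%E.
  have /sigma_finiteP[F [TF ndF Foo]] := sigma_finiteT (@lebesgue_measure R).
  have /sigma_finiteP[G [TG ndG Goo]] := sigma_finiteT mu.
  exists (fun k => F k `*` G k).
    rewrite -setXTT TF TG predeqE => -[x y]; split.
      move=> [/= [k _ Fkx] [l _ Gly]]; exists (maxn k l) => //; split.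
      - by move: x Fkx; exact/subsetPset/ndF/leq_maxl.
      - by move: y Gly; exact/subsetPset/ndG/leq_maxr.
    by move=> [k _ []/= ? ?]; split; exists k.
  move=> k; have [? ?] := Foo k; have [? ?] := Goo k.
  split; first exact: measurableX.
  by rewrite product_measure1E// lte_mul_pinfty// ge0_fin_numE.
have mb : measurable_fun [set: n.+1.-tuple (measurableTypeR R)]
    (fun t => (thead t, [tuple of behead t])).
  apply: measurable_fun_pair => /=; last exact: measurable_behead.
  exact: measurable_tnth.
have K : cancel tcons (fun t => (thead t, [tuple of behead t])).
  by case=> x t; congr pair; apply/val_inj.
exists (fun k => (fun t => (thead t, [tuple of behead t])) @^-1` F k).
  by rewrite -preimage_bigcup -UF preimage_setT.
move=> k; have [mFk Fk] := mF k; split.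
  by rewrite -[X in measurable X]setTI; exact: mb.
rewrite /product_step /pushforward (_ : _ @^-1` _ = F k)//.
by apply/seteqP; split=> p /=; rewrite K.
Qed.

HB.instance Definition _ := Measure_isSigmaFinite.Build _ _ _ product_step
  product_step_sigma_finite.
End product_step.

Fixpoint borel_lebesgue (R : realType) (n : nat) :
    {sigma_finite_measure set (n.-tuple (measurableTypeR R)) -> \bar R} :=
  match n with
  | 0 => \d_([tuple] : 0.-tuple (measurableTypeR R))
  | n'.+1 => product_step (borel_lebesgue R n')
  end.

(* The Lebesgue measure on R^n, defined on the Lebesgue-measurable sets: the
   complete extension of the product measure on the Borel sets, just as
   completed_lebesgue_measure is obtained in dimension 1.  The carrier Rn R n is
   n.-tuple R itself, with the sigma-algebra of Lebesgue-measurable sets. *)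
Definition Rn (R : realType) (n : nat) :=
  caratheodory_type ((borel_lebesgue R n)^*)%mu.
HB.instance Definition _ (R : realType) (n : nat) := Measurable.on (Rn R n).

Definition lebesgueRn (R : realType) (n : nat) : set (Rn R n) -> \bar R :=
  @completed_measure_extension _ _ _ (borel_lebesgue R n).
HB.instance Definition _ (R : realType) (n : nat) :=
  Measure.on (@lebesgueRn R n).

Section Euclidean.
Context (R : realType) (n : nat).
Implicit Types x y : n.-tuple R.

Definition enorm x : R := Num.sqrt (\sum_(i < n) tnth x i ^+ 2).
Definition tsub x y : n.-tuple R := [tuple tnth x i - tnth y i | i < n].
Definition tdiv x y : n.-tuple R := [tuple tnth x i / tnth y i | i < n].
Definition eball x (r : R) : set (n.-tuple R) := [set t | enorm (tsub t x) < r].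
Definition absp x : R := `|\prod_(i < n) tnth x i|.
Definition Rn0 : set (n.-tuple R) := [set x | absp x != 0].

End Euclidean.

Section complex_functions.
Context (R : realType) (n : nat).
Local Notation mu := (@lebesgueRn R n).
Implicit Types f g : Rn R n -> R[i].

Definition cmeasurable f : Prop :=
  measurable_fun setT (@complex.Re R \o f) /\
  measurable_fun setT (@complex.Im R \o f).

Definition cintegrable f : Prop :=
  mu.-integrable setT (EFin \o @complex.Re R \o f) /\
  mu.-integrable setT (EFin \o @complex.Im R \o f).

Definition cintegral f : R[i] :=
  Rintegral mu setT (@complex.Re R \o f) +i*
  Rintegral mu setT (@complex.Im R \o f).

Definition cLnorm (p : \bar R) f : \bar R :=
  'N[mu]_p[EFin \o @Normc.normc R \o f]%E.

Definition cLfun (p : \bar R) f : Prop := cmeasurable f /\ (cLnorm p f < +oo)%E.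

Definition cinner f g : R[i] := cintegral (fun t => f t * (g t)^*).

End complex_functions.

(* The spaces below consist of functions rather than of classes modulo a.e.
   equality; statements about classes are made explicit with {ae mu, ...}. *)
Section Morrey.
Context (R : realType) (n : nat).
Local Notation mu := (@lebesgueRn R n).
Implicit Types (nu : R) (f g : Rn R n -> R[i]).

Definition morrey_norm nu f : \bar R :=
  ereal_sup [set e | exists (x : Rn R n) (r : R), 0 < r /\
    e = ((r `^ nu)^-1%:E *
         \int[mu]_(t in eball x r) (Normc.normc (f t))%:E)%E].

Definition morrey nu f : Prop := cLfun 1%E f /\ (morrey_norm nu f < +oo)%E.

(* T induces a bounded linear operator on the Morrey space of classes. *)
Definition bounded_morrey_operator nu
    (T : (Rn R n -> R[i]) -> (Rn R n -> R[i])) : Prop :=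
  [/\ forall f, morrey nu f -> morrey nu (T f),
      forall f g, morrey nu f -> morrey nu g ->
        {ae mu, forall t, f t = g t} -> {ae mu, forall t, T f t = T g t},
      forall (c : R[i]) f g, morrey nu f -> morrey nu g ->
        {ae mu, forall t, T (fun s => c * f s + g s) t = c * T f t + T g t}
    & exists C : R, forall f, morrey nu f ->
        (morrey_norm nu (T f) <= C%:E * morrey_norm nu f)%E].

End Morrey.

Section fractional_wavelet.
Context (R : realType) (n : nat).
Local Notation mu := (@lebesgueRn R n).
Implicit Types (psi f : Rn R n -> R[i]) (alpha : R) (a b : Rn R n).

Definition expi (x : R) : R[i] := cos x +i* sin x.

Definition wavelet_atom psi alpha a b : Rn R n -> R[i] := fun t =>
  (Num.sqrt (absp a))^-1%:C * psi (tdiv (tsub t b) a) *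
  expi (- ((enorm t ^+ 2 - enorm b ^+ 2) * (cos alpha / sin alpha)) / 2).

Definition is_wavelet alpha psi : Prop :=
  [/\ cLfun 2%:E psi,
      ~ {ae mu, forall t, psi t = 0}
    & (\int[mu]_(a in @Rn0 R n) \int[mu]_b
        (Normc.normc (cinner (wavelet_atom psi alpha a b) psi) ^+ 2 /
         absp a ^+ 2)%:E < +oo)%E].

Definition wavelet_integrand psi alpha f b a : Rn R n -> R[i] :=
  fun t => f t * (wavelet_atom psi alpha a b t)^*.

Definition wavelet_transform psi alpha f b a : R[i] :=
  cintegral (wavelet_integrand psi alpha f b a).

End fractional_wavelet.

(* Main.v *)
Require Import Defs.
From mathcomp Require Import all_boot all_order all_algebra.
From mathcomp Require Import complex.
From mathcomp Require Import all_classical all_reals all_analysis.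
From mathcomp Require Import measurable_realfun ring.

Set Implicit Arguments.
Unset Strict Implicit.
Unset Printing Implicit Defensive.

Import Order.TTheory GRing.Theory Num.Theory.
Import numFieldNormedType.Exports.

Local Open Scope classical_set_scope.
Local Open Scope ring_scope.
Local Open Scope complex_scope.

(** The fractional chirp in the wavelet atom has modulus 1, so for every b

      |W f b| <= |a|_p^(-1/2) * int_t |f t| |psi ((t - b) / a)| dt
               = |a|_p^(1/2) * int_u |f (b + a u)| |psi u| du.

    Integrating over b in a ball B(x, r) and exchanging the integrals, the inner
    integral over b becomes the integral of |f| over the translated ball
    B(x + a u, r), which is at most r^nu times the Morrey norm of f whatever u
    is; what remains is the integral of |psi|.  The same computation with R^n
    in place of the ball bounds the L^1 norm of W f and shows that the integrals
    defining W f b converge for almost every b.  Both cases are instances of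
    [integral_normc_wavelet_integrand_le].

    The substitution and the exchange of integrals are elementary for Borel
    functions: [ge0_integral_borel_lebesgue_affine] is proved by induction on
    the dimension with Tonelli's theorem, and [dilated_convolution_integral]
    combines it with a second use of Tonelli.  For functions that are only
    Lebesgue measurable, it is not clear that (b, t) |-> f t * psi ((t - b) / a)
    is measurable for the product of the completed sigma-algebras, as Tonelli's
    theorem requires.  Hence f and psi are first replaced by Borel functions
    equal to them almost everywhere.  Such representatives exist
    because a Lebesgue-measurable set differs from a Borel set by a subset of a
    Borel null set ([caratheodory_hull]), and the replacement changes W f b for
    no b at all, since the affine maps t |-> (t - b) / a pull null sets back to
    null sets ([wavelet_representatives]).  In particular W f is everywhere
    equal to a Borel function. *)

(** * Borel hulls of Caratheodory-measurable sets *)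

Section measurable_hull.
Local Open Scope ereal_scope.
Context d (T : measurableType d) (R : realType).
Variable mu : {measure set T -> \bar R}.

(** The hull is the intersection of the unions of covers of A whose total
    measures tend to the outer measure of A. *)
Lemma outer_measurable_hull (A : set T) : (mu^*)%mu A < +oo ->
  exists F, [/\ measurable F, A `<=` F & mu F = (mu^*)%mu A].
Proof.
move=> Aoo.
have Afin : (mu^*)%mu A \is a fin_num by rewrite ge0_fin_numE// mu_ext_ge0.
have cover (k : nat) : exists F, [/\ measurable F, A `<=` F &
    mu F <= (mu^*)%mu A + k.+1%:R^-1%:E].
  have [_ [B [mB AB] <-] Blt] :
    exists2 x, [set \sum_(k <oo) mu (B k) | B in measurable_cover A] x &
      x < (mu^*)%mu A + k.+1%:R^-1%:E.
    by apply: lb_ereal_inf_adherent => //; rewrite invr_gt0.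
  exists (\bigcup_i B i); split => //; first exact: bigcupT_measurable.
  apply: le_trans (ltW Blt).
  by apply: measure_sigma_subadditive => //; exact: bigcupT_measurable.
have [F FP] := choice cover.
exists (\bigcap_k F k).
have mF : measurable (\bigcap_k F k).
  by apply: bigcapT_measurable => k; have [] := FP k.
have AF : A `<=` \bigcap_k F k by move=> t At k _; have [_ + _] := FP k; exact.
split => //; apply/eqP; rewrite eq_le; apply/andP; split.
- apply/lee_addgt0Pr => _/posnumP[e]; near \oo => k.
  have [mFk _ Fk] := FP k.
  apply: le_trans (_ : mu (F k) <= _).
    by apply: le_measure; rewrite ?inE//; exact: bigcap_inf.
  apply: le_trans Fk _; rewrite leeD2l// lee_fin ltW//.
  by near: k; exact: near_infty_natSinv_lt.
- by rewrite -(measurable_mu_extE mu mF); exact: le_mu_ext.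
Unshelve. all: by end_near. Qed.

(** On each piece of finite measure, A and its hull have the same measure, so
    their difference is null and its own hull is a Borel null set; the pieces
    are then glued along a countable cover of the space. *)
Lemma caratheodory_hull (A : set T) : sigma_finite [set: T] mu ->
    (mu^*)%mu.-caratheodory A ->
  exists F N, [/\ measurable F, measurable N, mu N = 0,
    A `<=` F & F `\` A `<=` N].
Proof.
move=> [S ST mS] cA.
have piece (i : nat) : exists FN : set T * set T, [/\ measurable FN.1,
    measurable FN.2, mu FN.2 = 0, A `&` S i `<=` FN.1 & FN.1 `\` A `<=` FN.2].
  have [mSi Sioo] := mS i.
  have cSi : (mu^*)%mu.-caratheodory (S i).
    by apply: (@caratheodory_measurable_mu_ext _ _ _ mu).
  have cASi : (mu^*)%mu.-caratheodory (A `&` S i).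
    exact: caratheodory_measurable_setI.
  have ASioo : (mu^*)%mu (A `&` S i) < +oo.
    apply: le_lt_trans Sioo; rewrite -(measurable_mu_extE mu mSi).
    exact: le_mu_ext.
  have [F [mF AF muF]] := outer_measurable_hull ASioo.
  have FA0 : (mu^*)%mu (F `\` (A `&` S i)) = 0.
    have -> : (mu^*)%mu (F `\` (A `&` S i)) =
        (mu^*)%mu F - (mu^*)%mu (F `&` (A `&` S i)).
      apply: (@measureD _ _ _ (@completed_measure_extension _ _ _ mu)) => //.
      - exact: (@caratheodory_measurable_mu_ext _ _ _ mu).
      - by change ((mu^*)%mu F < +oo); rewrite measurable_mu_extE// muF.
    rewrite setIidr// measurable_mu_extE// muF subee// ge0_fin_numE//.
    exact: mu_ext_ge0.
  have [N [mN FN muN]] :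
      exists N, [/\ measurable N, F `\` (A `&` S i) `<=` N &
        mu N = (mu^*)%mu (F `\` (A `&` S i))].
    by apply: outer_measurable_hull; rewrite FA0.
  exists (F, N); split => //=; first by rewrite muN.
  by apply: subset_trans FN => t [Ft At]; split => // -[].
have [FN FNP] := choice piece.
exists (\bigcup_i (FN i).1), (\bigcup_i (FN i).2); split.
- by apply: bigcupT_measurable => i; have [] := FNP i.
- by apply: bigcupT_measurable => i; have [] := FNP i.
- apply: measure_negligible.
    by apply: bigcupT_measurable => i; have [] := FNP i.
  by apply: negligible_bigcup => i; apply/negligibleP; have [] := FNP i.
- move=> t At; have [i _ Sit] : (\bigcup_i S i) t by rewrite -ST.
  by exists i => //; have [_ _ _ + _] := FNP i; exact.
- by move=> t [[i _ Fit] nAt]; exists i => //; have [_ _ _ _] := FNP i; exact.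
Qed.

(** Measurability of f is tested on the sets f > q with q rational: off the
    union N of the countably many exceptional null sets, each of them is the
    trace of its Borel hull. *)
Lemma caratheodory_measurable_ae_borel
    (f : caratheodory_type (mu^*)%mu -> R) :
    sigma_finite [set: T] mu -> measurable_fun setT f ->
  exists N : set T, [/\ measurable N, mu N = 0 &
    measurable_fun (~` N) (f : T -> R)].
Proof.
move=> sf mf.
pose r (k : nat) : rat := odflt 0%R (unpickle k).
have hull (k : nat) : exists FN : set T * set T, [/\ measurable FN.1,
    measurable FN.2, mu FN.2 = 0, f @^-1` `]ratr (r k), +oo[ `<=` FN.1 &
    FN.1 `\` f @^-1` `]ratr (r k), +oo[ `<=` FN.2].
  have cfq : (mu^*)%mu.-caratheodory (f @^-1` `]ratr (r k), +oo[).
    by rewrite -[X in _ X]setTI; apply: mf => //; exact: measurable_itv.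
  by have [F [N ?]] := caratheodory_hull sf cfq; exists (F, N).
have [FN FNP] := choice hull.
pose N := \bigcup_k (FN k).2.
have mN : measurable N.
  by apply: bigcupT_measurable => q; have [] := FNP q.
exists N; split => //.
  apply: measure_negligible => //.
  by apply: negligible_bigcup => k; apply/negligibleP; have [] := FNP k.
apply: (measurability _ (RGenOInfty.measurableE R)) => _ [_ [x ->] <-].
rewrite (_ : _ `&` _ =
    ~` N `&` \bigcup_(k in [set k | x < ratr (r k)]%R) (FN k).1).
  apply: measurableI; first exact: measurableC.
  rewrite bigcup_mkcond; apply: bigcupT_measurable => q.
  by case: ifPn => // _; have [] := FNP q.
apply/seteqP; split => [t [Nt]|t [Nt [q /= xq Ft]]].
- rewrite /= in_itv/= andbT => xft; split => //.
  have [q /itvP qx] := rat_in_itvoo xft.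
  have rq : r (pickle q) = q by rewrite /r pickleK.
  exists (pickle q); rewrite /= ?rq ?qx//.
  have [_ _ _ + _] := FNP (pickle q); apply.
  by rewrite /= in_itv/= andbT rq qx.
- split => //=; rewrite in_itv/= andbT; apply: contrapT => /negP nxft.
  apply: Nt; exists q => //; have [_ _ _ _] := FNP q; apply; split => //=.
  rewrite in_itv/= andbT => qf; move/negP: nxft; apply.
  exact: lt_trans qf.
Qed.
End measurable_hull.

(** * Affine change of variables for Borel functions on R^n *)

(** Applied to the affine maps of the line, to [tcons], and to the identity from
    the Lebesgue-measurable structure on R^n to the Borel one. *)
Lemma ge0_integral_measure_preserving (R : realType) d d' (X : measurableType d)
    (Y : measurableType d') (phi : X -> Y) (mu : {measure set X -> \bar R})
    (nu : {measure set Y -> \bar R}) (D : set Y) (f : Y -> \bar R) :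
    measurable_fun setT phi ->
    (forall A, measurable A -> mu (phi @^-1` A) = nu A) ->
    measurable D -> measurable_fun setT f -> (forall y, 0 <= f y)%E ->
  (\int[mu]_(x in phi @^-1` D) f (phi x) = \int[nu]_(y in D) f y)%E.
Proof.
move=> mphi munu mD mf f0.
have := @ge0_integral_pushforward _ _ _ _ R _ mphi mu D f
  mD (measurable_funTS mf) (fun t _ => f0 t).
move=> <-; apply: eq_measure_integral => A mA _.
exact: munu.
Qed.

Section change_of_variables.
Local Open Scope ereal_scope.
Context (R : realType).
Local Notation leb := (@lebesgue_measure R).

Definition affine1 (c a : R) (t : measurableTypeR R) : measurableTypeR R :=
  ((t - c) / a)%R.

Lemma measurable_affine1 c a : measurable_fun setT (affine1 c a).
Proof.
apply: (@measurable_funM _ _ _ setT (fun t : measurableTypeR R => t - c)%R).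
  by apply: measurable_funB => //; exact: measurable_id.
exact: measurable_cst.
Qed.

(** By uniqueness of the Lebesgue measure it suffices to compare both sides on
    intervals ]x, y]; dividing by a negative a reverses them. *)
Lemma pushforward_affine1 (c a : R) (A : set (measurableTypeR R)) :
    a != 0%R -> measurable A ->
  pushforward leb (affine1 c a) A = `|a|%:E * leb A.
Proof.
move=> a0 mA.
have a1 : (0 <= `|a|^-1)%R by rewrite invr_ge0.
have := @lebesgue_measure_unique R
  (mscale (NngNum a1) (pushforward leb (affine1 c a))).
move=> /(_ (measurable_affine1 c a) _ A mA) ->; last first.
  move=> _ [[x y] _ <-].
  change (leb `]x, y] = `|a|^-1%:E * leb (affine1 c a @^-1` `]x, y])).
  have [a_gt0|a_lt0|/eqP] := ltgtP 0%R a; last first.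
  - by rewrite eq_sym (negbTE a0).
  - have -> : affine1 c a @^-1` `]x, y] =
        `[(y * a + c)%R, (x * a + c)%R[%classic :> set R.
      rewrite predeqE => t /=; rewrite !in_itv/= /affine1.
      by rewrite ltr_ndivlMr// ler_ndivrMr// ltrBlDr lerBrDr andbC.
    rewrite !lebesgue_measure_itv/= !lte_fin ltrD2r ltr_nM2r//.
    case: ifPn => _; rewrite ?mule0// -!EFinB -EFinM.
    congr EFin; rewrite ltr0_norm//; field.
    by [].
  - have -> : affine1 c a @^-1` `]x, y] =
        `](x * a + c)%R, (y * a + c)%R]%classic :> set R.
      rewrite predeqE => t /=; rewrite !in_itv/= /affine1.
      by rewrite ltr_pdivlMr// ler_pdivrMr// ltrBrDr lerBlDr.
    rewrite !lebesgue_measure_itv/= !lte_fin ltrD2r ltr_pM2r//.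
    case: ifPn => _; rewrite ?mule0// -!EFinB -EFinM.
    congr EFin; rewrite gtr0_norm//; field.
    by [].
by rewrite /mscale/= muleA -EFinM divff ?normr_eq0// mul1e.
Qed.

Lemma ge0_integral_affine1 (g : measurableTypeR R -> \bar R) (c a : R) :
    a != 0%R -> measurable_fun setT g -> (forall t, 0 <= g t) ->
  \int[leb]_t g (affine1 c a t) = `|a|%:E * \int[leb]_t g t.
Proof.
move=> a0 mg g0.
rewrite -(@ge0_integral_mscale _ _ _ leb _ measurableT
  (NngNum (normr_ge0 a)))//.
rewrite -(@ge0_integral_measure_preserving _ _ _ _ _ (affine1 c a) leb _ setT g
  (measurable_affine1 c a) _ measurableT mg g0) ?preimage_setT// => A mA.
exact: (pushforward_affine1 c a0 mA).
Qed.
End change_of_variables.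

Section borel_lebesgue_change_of_variables.
Local Open Scope ereal_scope.
Context (R : realType).
Local Notation T n := (n.-tuple (measurableTypeR R)).
Local Notation leb := (@lebesgue_measure R).

Lemma measurable_tdiv_tsub n (d : measure_display) (X : measurableType d)
    (f g : X -> T n) (a : n.-tuple R) :
    measurable_fun setT f -> measurable_fun setT g ->
  measurable_fun setT (fun x => tdiv (tsub (f x) (g x)) a : T n).
Proof.
move=> /measurable_fun_tnthP mf /measurable_fun_tnthP mg.
apply/measurable_fun_tnthP => i.
rewrite (_ : _ \o _ = fun x => (tnth (f x) i - tnth (g x) i) / tnth a i)%R.
  apply: measurable_funM; last exact: measurable_cst.
  by apply: measurable_funB; [exact: mf|exact: mg].
by apply/funext => x /=; rewrite !tnth_mktuple.
Qed.

Lemma ge0_integral_borel_lebesgueS n (g : T n.+1 -> \bar R) :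
    measurable_fun setT g -> (forall t, 0 <= g t) ->
  \int[borel_lebesgue R n.+1]_t g t =
  \int[leb]_x \int[borel_lebesgue R n]_t g (tcons (x, t)).
Proof.
move=> mg g0.
rewrite -(@ge0_integral_measure_preserving _ _ _ _ _ (@tcons R n)
  (leb \x borel_lebesgue R n) (borel_lebesgue R n.+1) setT g
  (@measurable_tcons R n) _ measurableT mg g0)// preimage_setT.
rewrite (fubini_tonelli1 (fun p => g (tcons p)))//.
exact: (measurableT_comp mg (@measurable_tcons R n)).
Qed.

(** Induction on n: by Tonelli the first coordinate contributes the factor
    |a_0| and the remaining ones the product of the others. *)
Lemma ge0_integral_borel_lebesgue_affine n (g : T n -> \bar R)
    (b a : n.-tuple R) :
    absp a != 0%R -> measurable_fun setT g -> (forall t, 0 <= g t) ->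
  \int[borel_lebesgue R n]_t g (tdiv (tsub t b) a) =
  (absp a)%:E * \int[borel_lebesgue R n]_t g t.
Proof.
elim: n => [|n IH] in g b a *.
  move=> _ mg g0.
  rewrite /absp big_ord0 normr1 mul1e; apply: eq_integral => t _.
  by congr g; rewrite [LHS]tuple0 [RHS]tuple0.
rewrite /absp big_ord_recl normrM mulf_eq0 negb_or => /andP[a0 aS] mg g0.
have mphi : measurable_fun setT (fun t : T n.+1 => tdiv (tsub t b) a : T n.+1).
  apply: measurable_tdiv_tsub; first exact: measurable_id.
  exact: measurable_cst.
rewrite !ge0_integral_borel_lebesgueS//; last by apply: measurableT_comp.
pose b' := [tuple tnth b (lift ord0 i) | i < n].
pose a' := [tuple tnth a (lift ord0 i) | i < n].
have absa' : absp a' = `|\prod_(i < n) tnth a (lift ord0 i)|%R.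
  by rewrite /absp; congr (`|_|)%R; apply: eq_bigr => i _; rewrite tnth_mktuple.
have phiE x t : tdiv (tsub (tcons (x, t)) b) a =
    tcons (affine1 (tnth b ord0) (tnth a ord0) x, tdiv (tsub t b') a').
  apply: eq_from_tnth => i; rewrite !tnth_mktuple.
  have [->|[j ->]] : i = ord0 \/ exists j, i = lift ord0 j.
    by case: (unliftP ord0 i) => [j ->|->]; [right; exists j|left].
  - by rewrite /tcons/= !tnth0.
  - by rewrite /tcons/= !tnthS !tnth_mktuple.
pose G x := \int[borel_lebesgue R n]_t g (tcons (x, t)).
have mgt : measurable_fun setT (g \o @tcons R n).
  by apply: measurableT_comp => //; exact: measurable_tcons.
have mG : measurable_fun setT G.
  apply: (@measurable_fun_fubini_tonelli_F _ _ _ _ R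
    (borel_lebesgue R n) _ mgt).
  by move=> p; exact: g0.
have G0 x : 0 <= G x by apply: integral_ge0.
transitivity (\int[leb]_x
    ((absp a')%:E * G (affine1 (tnth b ord0) (tnth a ord0) x))).
  apply: eq_integral => x _; under eq_integral do rewrite phiE.
  rewrite (IH (fun t => g (tcons (_, t))))//.
  - by rewrite absa' -normr_eq0 normr_id normr_eq0 -normr_eq0.
  - exact: (measurableT_comp mgt (pair1_measurable _)).
have mGa := measurableT_comp mG
  (measurable_affine1 (tnth b ord0) (tnth a ord0)).
rewrite (ge0_integralZl leb measurableT mGa); last 2 first.
- by move=> x _; exact: G0.
- by rewrite lee_fin normr_ge0.
rewrite ge0_integral_affine1//; last by rewrite -normr_eq0.
by rewrite absa' muleCA EFinM muleA.
Qed.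
End borel_lebesgue_change_of_variables.

(** * Lebesgue integrals of Borel functions *)

Section lebesgueRn_borel.
Local Open Scope ereal_scope.
Context (R : realType) (n : nat).
Local Notation T := (n.-tuple (measurableTypeR R)).
Local Notation leb := (borel_lebesgue R n).
Local Notation mu := (@lebesgueRn R n).

Lemma measurable_Rn (A : set T) : measurable A -> measurable (A : set (Rn R n)).
Proof. by move=> mA; exact: (@caratheodory_measurable_mu_ext _ _ _ leb). Qed.

Lemma lebesgueRnE (A : set T) : measurable A -> mu A = leb A.
Proof. by move=> mA; exact: measurable_mu_extE. Qed.

Lemma lebesgueRn_complete : measure_is_complete mu.
Proof. exact: measure_is_complete_caratheodory. Qed.

Lemma measurable_Rn_id : measurable_fun setT (id : Rn R n -> T).
Proof. by move=> _ A mA; rewrite setTI; exact: measurable_Rn. Qed.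

Lemma measurable_fun_Rn d (X : measurableType d) (f : T -> X) :
  measurable_fun setT f -> measurable_fun setT (f : Rn R n -> X).
Proof. by move=> mf; exact: (measurableT_comp mf measurable_Rn_id). Qed.

Lemma ge0_integral_lebesgueRn (D : set T) (f : T -> \bar R) :
    measurable D -> measurable_fun setT f -> (forall t, 0 <= f t) ->
  \int[mu]_(t in D) f t = \int[leb]_(t in D) f t.
Proof.
move=> mD mf f0.
exact: (ge0_integral_measure_preserving measurable_Rn_id lebesgueRnE mD mf f0).
Qed.

Lemma integral_lebesgueRn (f : T -> \bar R) : measurable_fun setT f ->
  \int[mu]_t f t = \int[leb]_t f t.
Proof.
move=> mf; rewrite integralE [RHS]integralE.
by rewrite !ge0_integral_lebesgueRn//; [exact: measurable_funeneg|
  exact: measurable_funepos].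
Qed.

End lebesgueRn_borel.

(** * Complex-valued measurable functions and Borel representatives *)

Section complex_measurability.
Context (R : realType) d (X : measurableType d).
Implicit Types f g : X -> R[i].

(** On [Rn R n] this is [cmeasurable]; Borel functions on R^n and on R^n x R^n
    are other cases. *)
Definition complex_measurable f : Prop :=
  measurable_fun setT (@complex.Re R \o f) /\
  measurable_fun setT (@complex.Im R \o f).

Lemma complex_measurableM f g : complex_measurable f -> complex_measurable g ->
  complex_measurable (fun x => f x * g x).
Proof.
move=> [rf If] [rg ig]; split.
- rewrite (_ : _ \o _ = (fun x => complex.Re (f x) * complex.Re (g x) -
    complex.Im (f x) * complex.Im (g x))).
    by apply: measurable_funB; apply: measurable_funM.
  by apply/funext => x /=; case: (f x) (g x) => [? ?] [? ?].
- rewrite (_ : _ \o _ = (fun x => complex.Re (f x) * complex.Im (g x) +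
    complex.Im (f x) * complex.Re (g x))).
    by apply: measurable_funD; apply: measurable_funM.
  by apply/funext => x /=; case: (f x) (g x) => [? ?] [? ?].
Qed.

Lemma complex_measurable_conj f : complex_measurable f ->
  complex_measurable (fun x => (f x)^*).
Proof.
move=> [rf If]; split.
- rewrite (_ : _ \o _ = @complex.Re R \o f)//.
  by apply/funext => x /=; case: (f x).
- rewrite (_ : _ \o _ = (fun x => - complex.Im (f x))).
    exact: measurable_funN.
  by apply/funext => x /=; case: (f x).
Qed.

Lemma complex_measurable_cst (c : R[i]) : complex_measurable (fun=> c).
Proof. by split; exact: measurable_cst. Qed.

Lemma complex_measurable_expi (u : X -> R) : measurable_fun setT u ->
  complex_measurable (fun x => expi (u x)).
Proof.
move=> mu; split.
- apply: (measurableT_comp _ mu).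
  by apply: continuous_measurable_fun => x; exact: continuous_cos.
- apply: (measurableT_comp _ mu).
  by apply: continuous_measurable_fun => x; exact: continuous_sin.
Qed.

Lemma measurable_normc f : complex_measurable f ->
  measurable_fun setT (@Normc.normc R \o f).
Proof.
move=> [rf If]; rewrite (_ : _ \o _ =
    @Num.sqrt R \o (fun x => complex.Re (f x) ^+ 2 + complex.Im (f x) ^+ 2)).
  apply: measurableT_comp.
    by apply: continuous_measurable_fun => x; exact: sqrt_continuous.
  by apply: measurable_funD; apply: measurable_funX.
by apply/funext => x /=; case: (f x).
Qed.

End complex_measurability.

Lemma complex_measurable_comp (R : realType) d (X : measurableType d) d'
    (Y : measurableType d') (f : X -> R[i]) (h : Y -> X) :
  complex_measurable f -> measurable_fun setT h -> complex_measurable (f \o h).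
Proof.
move=> [rf If] mh.
by split; [exact: (measurableT_comp rf)|exact: (measurableT_comp If)].
Qed.

Lemma complex_measurable_zero_on (R : realType) d (X : measurableType d)
    (f : X -> R[i]) (N : set X) : measurable N ->
    measurable_fun (~` N) (@complex.Re R \o f) ->
    measurable_fun (~` N) (@complex.Im R \o f) ->
  complex_measurable (fun t => if t \in N then 0 else f t).
Proof.
move=> mN rf If; have mNC : measurable (~` N) by exact: measurableC.
split.
- rewrite (_ : _ \o _ = (@complex.Re R \o f) \_ ~` N).
    exact/(measurable_restrictT _ mNC).
  by apply/funext => x; rewrite /= /patch in_setC; case: ifP.
- rewrite (_ : _ \o _ = (@complex.Im R \o f) \_ ~` N).
    exact/(measurable_restrictT _ mNC).
  by apply/funext => x; rewrite /= /patch in_setC; case: ifP.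
Qed.

Section complex_Rn.
Context (R : realType) (n : nat).
Local Notation T := (n.-tuple (measurableTypeR R)).
Local Notation leb := (borel_lebesgue R n).
Local Notation mu := (@lebesgueRn R n).
Implicit Types f g : Rn R n -> R[i].

Lemma cmeasurable_borel (f : T -> R[i]) : complex_measurable f ->
  cmeasurable (f : Rn R n -> R[i]).
Proof.
by move=> [rf If]; split; apply: measurable_fun_Rn.
Qed.

(** The representative vanishes on a Borel null set off which f is Borel. *)
Lemma cmeasurable_representative f : cmeasurable f ->
  exists (g : T -> R[i]) (N : set T), [/\ complex_measurable g, measurable N,
    leb N = 0%E & forall t, ~ N t -> f t = g t].
Proof.
move=> [rf If].
have [M [mM M0 rfM]] := caratheodory_measurable_ae_borel (sigma_finiteT leb) rf.
have [N [mN N0 ifN]] := caratheodory_measurable_ae_borel (sigma_finiteT leb) If.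
have mMN : measurable (M `|` N) by exact: measurableU.
exists (fun t : T => if t \in (M `|` N) then 0 else f t), (M `|` N).
split => //.
- apply: complex_measurable_zero_on => //.
  + apply: measurable_funS rfM; first exact: measurableC.
    by apply: subsetC => t; left.
  + apply: measurable_funS ifN; first exact: measurableC.
    by apply: subsetC => t; right.
- by rewrite measureU0.
- by move=> t Nt; rewrite memNset.
Qed.

(** The completeness of the measure makes every modification of f on a null set
    measurable. *)
Lemma ae_eq_cmeasurable f g : cmeasurable f -> {ae mu, forall t, f t = g t} ->
  cmeasurable g.
Proof.
move=> [rf If] fg.
split; apply/measurable_EFinP.
- apply: (ae_measurable_fun (lebesgueRn_complete (R:=R) (n:=n)))
    ((measurable_EFinP _ _).2 rf).
  by apply: filterS fg => t ft _; rewrite /= ft.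
- apply: (ae_measurable_fun (lebesgueRn_complete (R:=R) (n:=n)))
    ((measurable_EFinP _ _).2 If).
  by apply: filterS fg => t ft _; rewrite /= ft.
Qed.

Lemma ae_eq_cintegral f g : cmeasurable f -> {ae mu, forall t, f t = g t} ->
  cintegral f = cintegral g.
Proof.
move=> mf fg; have [rg ig] := ae_eq_cmeasurable mf fg; case: mf => rf If.
rewrite /cintegral /Rintegral; congr (fine _ +i* fine _).
- apply: ae_eq_integral; [exact: measurableT|exact/measurable_EFinP|
    exact/measurable_EFinP|].
  by apply: filterS fg => t ft _; rewrite /= ft.
- apply: ae_eq_integral; [exact: measurableT|exact/measurable_EFinP|
    exact/measurable_EFinP|].
  by apply: filterS fg => t ft _; rewrite /= ft.
Qed.

Lemma cLnorm1E f : cLnorm 1 f = (\int[mu]_t (Normc.normc (f t))%:E)%E.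
Proof.
rewrite /cLnorm Lnorm1; apply: eq_integral => t _ /=.
by rewrite ger0_norm//; case: (f t) => ? ? /=; exact: sqrtr_ge0.
Qed.
End complex_Rn.

(** * Integral of a dilated convolution *)

Section dilated_convolution.
Local Open Scope ereal_scope.
Context (R : realType) (n : nat).
Local Notation T := (n.-tuple (measurableTypeR R)).
Local Notation leb := (borel_lebesgue R n).
Implicit Types (a b u x : T) (F G : T -> \bar R) (D : set T).

(** The inverse of t |-> (t - b) / a, as a function of u. *)
Definition tshift a b u : T := [tuple tnth b i + tnth a i * tnth u i | i < n]%R.

Lemma tshift_tdiv_tsub a b u : absp (a : n.-tuple R) != 0%R ->
  tshift a b (tdiv (tsub u b) a) = u.
Proof.
rewrite /absp normr_eq0 => /prodf_neq0 a0.
apply: eq_from_tnth => i; rewrite !tnth_mktuple mulrC divfK ?a0//.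
by rewrite addrC subrK.
Qed.

Lemma measurable_tshift a :
  measurable_fun setT (fun p : T * T => tshift a p.1 p.2).
Proof.
apply/measurable_fun_tnthP => i.
rewrite (_ : _ \o _ = fun p : T * T => (tnth p.1 i + tnth a i * tnth p.2 i)%R).
  apply: measurable_funD.
    exact: (measurableT_comp (measurable_tnth i) measurable_fst).
  apply: measurable_funM; first exact: measurable_cst.
  exact: (measurableT_comp (measurable_tnth i) measurable_snd).
by apply/funext => p /=; rewrite tnth_mktuple.
Qed.

(** Translation by a u: for a ball D of center x, D' is the ball of the same
    radius with center [tshift a x u]. *)
Lemma ge0_integral_tshift D D' F a u : measurable D -> measurable_fun setT F ->
    (forall t, 0 <= F t) -> (forall b, D b <-> D' (tshift a b u)) ->
  \int[leb]_(b in D) F (tshift a b u) = \int[leb]_(s in D') F s.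
Proof.
move=> mD mF F0 DD'.
pose c : n.-tuple R := tshift a [tuple 0%R | _ < n] u.
(* A translation is the affine change of variables with all scales 1. *)
pose e : n.-tuple R := [tuple 1%R | _ < n].
have e1 : absp e = 1%R.
  by rewrite /absp big1 ?normr1// => i _; rewrite tnth_mktuple.
have shiftE s : tshift a (tdiv (tsub s c) e) u = s.
  apply: eq_from_tnth => i; rewrite !tnth_mktuple divr1 add0r.
  by rewrite subrK.
have mt : measurable_fun setT (fun b => tshift a b u).
  exact: (measurableT_comp (measurable_tshift a) (pair2_measurable u)).
rewrite integral_mkcond [RHS]integral_mkcond.
have := @ge0_integral_borel_lebesgue_affine R n
  ((fun b => F (tshift a b u)) \_ D) c e.
rewrite e1 mul1e oner_neq0 => <-//.
- apply: eq_integral => s _; rewrite /patch shiftE.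
  congr (if _ then _ else _).
  have := DD' (tdiv (tsub s c) e); rewrite shiftE => DD's.
  by apply/idP/idP; rewrite !inE; apply DD's.
- apply/(measurable_restrictT _ mD); apply: measurable_funTS.
  exact: measurableT_comp.
- by move=> t; rewrite /patch; case: ifP.
Qed.

(** Substitute t = b + a u in the inner integral, then exchange the integrals.
    After the exchange G u no longer depends on b, so only a translate of F is
    integrated over D. *)
Lemma dilated_convolution_integral D F G a : absp (a : n.-tuple R) != 0%R ->
    measurable D ->
    measurable_fun setT F -> measurable_fun setT G ->
    (forall t, 0 <= F t) -> (forall t, 0 <= G t) ->
  \int[leb]_(b in D) \int[leb]_t (F t * G (tdiv (tsub t b) a)) =
  (absp (a : n.-tuple R))%:E *
  \int[leb]_u (G u * \int[leb]_(b in D) F (tshift a b u)).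
Proof.
move=> a0 mD mF mG F0 G0.
have mFG : measurable_fun setT
    (fun p : T * T => F (tshift a p.1 p.2) * G p.2).
  apply: emeasurable_funM.
    exact: (measurableT_comp mF (measurable_tshift a)).
  exact: (measurableT_comp mG measurable_snd).
have mFGD : measurable_fun setT
    (fun p : T * T => F (tshift a p.1 p.2) * G p.2 * (\1_D p.1)%:E).
  apply: emeasurable_funM => //; apply/measurable_EFinP.
  by apply: (measurableT_comp _ measurable_fst); exact: measurable_indic.
have inner b : \int[leb]_t (F t * G (tdiv (tsub t b) a)) =
    (absp (a : n.-tuple R))%:E * \int[leb]_u (F (tshift a b u) * G u).
  rewrite -(@ge0_integral_borel_lebesgue_affine R n
    (fun u => F (tshift a b u) * G u) b a)//.
  - by apply: eq_integral => t _; rewrite tshift_tdiv_tsub.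
  - exact: (measurableT_comp mFG (pair1_measurable b)).
  - by move=> t; exact: mule_ge0.
under eq_integral do rewrite inner.
rewrite ge0_integralZl//; last 3 first.
- apply: measurable_funTS.
  apply: (@measurable_fun_fubini_tonelli_F _ _ _ _ R leb _ mFG) => p.
  exact: mule_ge0.
- by move=> b _; apply: integral_ge0 => u _; exact: mule_ge0.
- by rewrite lee_fin normr_ge0.
congr (_ * _).
rewrite integral_mkcond epatch_indic.
transitivity (\int[leb]_b \int[leb]_u (F (tshift a b u) * G u * (\1_D b)%:E)).
  apply: eq_integral => b _ /=; rewrite ge0_integralZr//.
  - exact: (measurableT_comp mFG (pair1_measurable b)).
  - by move=> t _; exact: mule_ge0.
rewrite (@fubini_tonelli _ _ _ _ R leb leb
  (fun p : T * T =>
    F (tshift a p.1 p.2) * G p.2 * (\1_D p.1)%:E))//; last first.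
  by move=> p; rewrite !mule_ge0.
apply: eq_integral => u _ /=.
rewrite [in RHS]integral_mkcond epatch_indic /=.
rewrite -ge0_integralZl//.
- by apply: eq_integral => b _ /=; rewrite muleCA muleA.
- apply: emeasurable_funM.
    exact: (measurableT_comp mF
      (measurableT_comp (measurable_tshift a) (pair2_measurable u))).
  by apply/measurable_EFinP; exact: measurable_indic.
- by move=> b _; rewrite mule_ge0.
Qed.

End dilated_convolution.

(** * Integrals of complex-valued functions *)

Section normc.
Context (R : realType).
Implicit Types z w : R[i].

Lemma normc_ge0 z : 0 <= Normc.normc z.
Proof. by case: z => x y; exact: sqrtr_ge0. Qed.

Lemma ler_norm_Re_normc z : `|complex.Re z| <= Normc.normc z.
Proof.
case: z => x y /=; rewrite -sqrtr_sqr ler_sqrt ?lerDl ?sqr_ge0//.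
by rewrite addr_ge0 ?sqr_ge0.
Qed.

Lemma ler_norm_Im_normc z : `|complex.Im z| <= Normc.normc z.
Proof.
case: z => x y /=; rewrite -sqrtr_sqr ler_sqrt ?lerDr ?sqr_ge0//.
by rewrite addr_ge0 ?sqr_ge0.
Qed.

Lemma sqr_normcE z : Normc.normc z ^+ 2 = complex.Re z ^+ 2 + complex.Im z ^+ 2.
Proof. by case: z => x y /=; rewrite sqr_sqrtr// addr_ge0 ?sqr_ge0. Qed.

(** The left-hand side is the real part of the product of the conjugate of z
    and w. *)
Lemma dot_le_normc z w :
  complex.Re z * complex.Re w + complex.Im z * complex.Im w <=
  Normc.normc z * Normc.normc w.
Proof.
have -> : Normc.normc z * Normc.normc w = Normc.normc (z^* * w).
  by rewrite Normc.normcM; congr (_ * _); case: z => x y /=; rewrite sqrrN.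
apply: le_trans (ler_norm _) _; apply: le_trans (ler_norm_Re_normc _).
by case: z w => [x y] [x' y'] /=; rewrite mulNr opprK.
Qed.

Lemma normc_conj z : Normc.normc z^* = Normc.normc z.
Proof. by case: z => x y /=; rewrite sqrrN. Qed.

Lemma normc_expi (x : R) : Normc.normc (expi x) = 1.
Proof. by rewrite /= cos2Dsin2 sqrtr1. Qed.

Lemma normc_real (x : R) : Normc.normc (x%:C) = `|x|.
Proof. by rewrite /= expr0n/= addr0 sqrtr_sqr. Qed.

End normc.

Section complex_integral.
Local Open Scope ereal_scope.
Context (R : realType) d (X : measurableType d).
Variable mu : {measure set X -> \bar R}.
Implicit Types f g : X -> R[i].

Definition complex_integrable f : Prop :=
  mu.-integrable setT (EFin \o @complex.Re R \o f) /\
  mu.-integrable setT (EFin \o @complex.Im R \o f).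

Definition complex_integral f : R[i] :=
  (Rintegral mu setT (@complex.Re R \o f) +i*
   Rintegral mu setT (@complex.Im R \o f))%C.

Lemma complex_integrable_normc f : complex_measurable f ->
  \int[mu]_t (Normc.normc (f t))%:E < +oo -> complex_integrable f.
Proof.
move=> mf fi; have mn := measurable_normc mf; case: mf => rf If.
split; apply/integrableP; split; try exact/measurable_EFinP.
- apply: le_lt_trans fi; apply: ge0_le_integral => //.
  + by apply: measurableT_comp => //; exact/measurable_EFinP.
  + exact/measurable_EFinP.
  + by move=> t _; rewrite lee_fin ler_norm_Re_normc.
- apply: le_lt_trans fi; apply: ge0_le_integral => //.
  + by apply: measurableT_comp => //; exact/measurable_EFinP.
  + exact/measurable_EFinP.
  + by move=> t _; rewrite lee_fin ler_norm_Im_normc.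
Qed.

(** With z the integral of f, |z|^2 is the integral of Re z Re f + Im z Im f,
    which is at most |z| times the integral of |f|.  Without integrability
    the right-hand side is infinite. *)
Lemma normc_complex_integral_le f : complex_measurable f ->
  (Normc.normc (complex_integral f))%:E <= \int[mu]_t (Normc.normc (f t))%:E.
Proof.
move=> mf.
have [fi|] := ltP (\int[mu]_t (Normc.normc (f t))%:E) +oo; last first.
  by rewrite leye_eq => /eqP ->; rewrite leey.
have [ri ii] := complex_integrable_normc mf fi.
have mn := measurable_normc mf.
set I := \int[mu]_t _ in fi *.
have I0 : 0 <= I by apply: integral_ge0 => t _; rewrite lee_fin normc_ge0.
have Ifin : I \is a fin_num by rewrite ge0_fin_numE.
rewrite -(fineK Ifin) lee_fin.
set z := complex_integral f.
have [->|z0] := eqVneq (Normc.normc z) 0%R; first by rewrite fine_ge0.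
have zgt0 : (0 < Normc.normc z)%R by rewrite lt_neqAle eq_sym z0 normc_ge0.
rewrite -(ler_pM2l zgt0) -expr2 sqr_normcE -lee_fin.
have rzi : mu.-integrable setT
    (fun t => (complex.Re z)%:E * (complex.Re (f t))%:E).
  exact: integrableZl.
have izi : mu.-integrable setT
    (fun t => (complex.Im z)%:E * (complex.Im (f t))%:E).
  exact: integrableZl.
have -> : (complex.Re z ^+ 2 + complex.Im z ^+ 2)%:E =
  \int[mu]_t ((complex.Re z)%:E * (complex.Re (f t))%:E +
              (complex.Im z)%:E * (complex.Im (f t))%:E).
  rewrite integralD// !integralZl// EFinD !expr2 !EFinM.
  by rewrite /z/= /Rintegral !fineK//; exact: integrable_fin_num.
have mnE : measurable_fun setT (fun t => (Normc.normc (f t))%:E).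
  exact/measurable_EFinP.
rewrite EFinM (fineK Ifin) /I.
rewrite -(ge0_integralZl mu measurableT mnE); last 2 first.
- by move=> t _; rewrite lee_fin normc_ge0.
- by rewrite lee_fin normc_ge0.
apply: le_integral => //.
- exact: integrableD.
- apply: integrableZl => //; apply/integrableP.
  split; first exact/measurable_EFinP.
  by under eq_integral do rewrite /= ger0_norm ?normc_ge0//.
- by move=> t _; rewrite -!EFinM -EFinD lee_fin dot_le_normc.
Qed.

Lemma complex_integral_linear (c : R[i]) f g :
    complex_integrable f -> complex_integrable g ->
  complex_integral (fun t => c * f t + g t)%R =
  (c * complex_integral f + complex_integral g)%R.
Proof.
have ZlE (r : R) (h : X -> R) : mu.-integrable setT (EFin \o h) ->
    mu.-integrable setT (EFin \o (fun t => r * h t)%R).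
  by move=> hi; exact: (integrableZl measurableT r hi).
have DE (h k : X -> R) : mu.-integrable setT (EFin \o h) ->
    mu.-integrable setT (EFin \o k) ->
    mu.-integrable setT (EFin \o (fun t => h t + k t)%R).
  by move=> hi ki; exact: (integrableD measurableT hi ki).
case: c => x y [rf If] [rg ig]; rewrite /complex_integral.
have -> : (@complex.Re R \o (fun t => (x +i* y)%C * f t + g t)%R) =
  (fun t => (x * complex.Re (f t) + - y * complex.Im (f t)) +
    complex.Re (g t))%R.
  by apply/funext => t /=; case: (f t) (g t) => [? ?] [? ?] /=; rewrite mulNr.
have -> : (@complex.Im R \o (fun t => (x +i* y)%C * f t + g t)%R) =
  (fun t => (x * complex.Im (f t) + y * complex.Re (f t)) + complex.Im (g t))%R.
  by apply/funext => t /=; case: (f t) (g t) => [? ?] [? ?].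
rewrite !RintegralD//; try by [exact: ZlE|apply: DE; exact: ZlE].
by rewrite !RintegralZl// mulNr.
Qed.

End complex_integral.

Section complex_integral_Rn.
Local Open Scope ereal_scope.
Context (R : realType) (n : nat).
Local Notation T := (n.-tuple (measurableTypeR R)).
Local Notation leb := (borel_lebesgue R n).
Local Notation mu := (@lebesgueRn R n).
Implicit Types f g : Rn R n -> R[i].

Lemma cintegrable_normc f : cmeasurable f ->
  \int[mu]_t (Normc.normc (f t))%:E < +oo -> cintegrable f.
Proof. exact: complex_integrable_normc. Qed.

Lemma normc_cintegral_le f : cmeasurable f ->
  (Normc.normc (cintegral f))%:E <= \int[mu]_t (Normc.normc (f t))%:E.
Proof. exact: normc_complex_integral_le. Qed.

Lemma cintegral_linear (c : R[i]) f g : cintegrable f -> cintegrable g ->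
  cintegral (fun t => c * f t + g t)%R = (c * cintegral f + cintegral g)%R.
Proof. exact: complex_integral_linear. Qed.

(** Integrals of positive and negative parts depend measurably on b by Tonelli,
    and [fine] is measurable on the whole extended line, which takes care of the
    b for which an integral diverges. *)
Lemma cmeasurable_cintegral (h : T * T -> R[i]) : complex_measurable h ->
  complex_measurable (fun b : T => cintegral (fun t : Rn R n => h (b, t))).
Proof.
have meas (k : T * T -> R) : measurable_fun setT k ->
    measurable_fun setT
      (fun b : T => Rintegral mu setT (fun t : Rn R n => k (b, t))).
  move=> mk; rewrite /Rintegral.
  apply: (measurableT_comp (fine_measurable measurableT)).
  have mk1 b : measurable_fun setT (fun t : T => (k (b, t))%:E).
    apply/measurable_EFinP.
    exact: (measurableT_comp mk (pair1_measurable b)).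
  under [X in measurable_fun _ X]eq_fun
    do rewrite (integral_lebesgueRn (mk1 _)) integralE.
  have mkE : measurable_fun setT (EFin \o k) by exact/measurable_EFinP.
  apply: emeasurable_funB.
  - have := @measurable_fun_fubini_tonelli_F _ _ _ _ R leb _
      (measurable_funepos mkE) (fun p => funepos_ge0 _ p).
    congr (measurable_fun _ _); apply/funext => b; apply: eq_integral => t _.
    by rewrite !funeposE.
  - have := @measurable_fun_fubini_tonelli_F _ _ _ _ R leb _
      (measurable_funeneg mkE) (fun p => funeneg_ge0 _ p).
    congr (measurable_fun _ _); apply/funext => b; apply: eq_integral => t _.
    by rewrite !funenegE.
by move=> [rh ih]; split; [exact: (meas _ rh)|exact: (meas _ ih)].
Qed.

End complex_integral_Rn.

(** * The wavelet integrand for Borel functions *)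

Section euclidean_measurability.
Context (R : realType) (n : nat).
Local Notation T := (n.-tuple (measurableTypeR R)).

Lemma measurable_enorm : measurable_fun setT (@enorm R n : T -> R).
Proof.
rewrite (_ : (@enorm R n : T -> R) =
    @Num.sqrt R \o (fun x : T => \sum_(i < n) tnth x i ^+ 2))//.
apply: measurableT_comp.
  by apply: continuous_measurable_fun => x; exact: sqrt_continuous.
apply: measurable_sum => i; apply: measurable_funX.
exact: (measurable_tnth i).
Qed.

Lemma measurable_eball (x : T) (r : R) : measurable (eball x r : set T).
Proof.
have mt : measurable_fun setT (fun t : T => enorm (tsub t x)).
  have -> : (fun t : T => enorm (tsub t x)) =
      @enorm R n \o (fun t => tdiv (tsub t x) [tuple 1 | _ < n]).
    apply/funext => t /=; congr enorm; apply: eq_from_tnth => i.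
    by rewrite !tnth_mktuple divr1.
  apply: (measurableT_comp measurable_enorm).
  by apply: measurable_tdiv_tsub; [exact: measurable_id|exact: measurable_cst].
have := mt measurableT _ (measurable_itv `]-oo, r[).
by rewrite setTI; congr measurable; rewrite predeqE => t; rewrite /= in_itv.
Qed.

Lemma eball_tshift (a b u x : T) (r : R) :
  eball x r b <-> eball (tshift a x u) r (tshift a b u).
Proof.
rewrite /eball/=; set p := tsub b x; set q := tsub _ _.
suff -> : p = q by [].
apply: eq_from_tnth => i; rewrite /p /q !tnth_mktuple.
by rewrite opprD addrACA subrr addr0.
Qed.
End euclidean_measurability.

Section wavelet_borel.
Local Open Scope ereal_scope.
Context (R : realType) (n : nat) (alpha : R).
Local Notation T := (n.-tuple (measurableTypeR R)).
Local Notation leb := (borel_lebesgue R n).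
Local Notation mu := (@lebesgueRn R n).
Implicit Types (a b : T) (f psi : T -> R[i]).

Lemma measurable_wavelet_integrand f psi a :
    complex_measurable f -> complex_measurable psi ->
  complex_measurable (fun p : T * T => wavelet_integrand psi alpha f p.1 a p.2).
Proof.
move=> mf mpsi; apply: complex_measurableM.
  exact: (complex_measurable_comp mf measurable_snd).
apply: complex_measurable_conj; apply: complex_measurableM.
  apply: complex_measurableM; first exact: complex_measurable_cst.
  apply: (complex_measurable_comp mpsi).
  exact: (measurable_tdiv_tsub _ measurable_snd measurable_fst).
apply: complex_measurable_expi.
apply: measurable_funM; last exact: measurable_cst.
apply: measurable_funN; apply: measurable_funM; last exact: measurable_cst.
apply: measurable_funB; apply: measurable_funX.
  exact: (measurableT_comp (@measurable_enorm R n) measurable_snd).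
exact: (measurableT_comp (@measurable_enorm R n) measurable_fst).
Qed.

Lemma normc_wavelet_integrand f psi a b t :
  Normc.normc (wavelet_integrand psi alpha f b a t) =
  ((Num.sqrt (absp a))^-1 *
   (Normc.normc (f t) * Normc.normc (psi (tdiv (tsub t b) a))))%R.
Proof.
rewrite /wavelet_integrand Normc.normcM normc_conj /wavelet_atom !Normc.normcM.
rewrite normc_expi mulr1 normc_real ger0_norm ?invr_ge0 ?sqrtr_ge0//.
by rewrite mulrCA.
Qed.

(** The factors 1 / sqrt |a|_p of the atom and |a|_p of the substitution combine
    into sqrt |a|_p. *)
Lemma integral_wavelet_integrand_le (D : set T) (C : \bar R) f psi a :
    absp (a : n.-tuple R) != 0%R -> measurable D ->
    complex_measurable f -> complex_measurable psi ->
    (forall u, \int[leb]_(b in D) (Normc.normc (f (tshift a b u)))%:E <= C) ->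
  \int[leb]_(b in D) \int[leb]_t
    (Normc.normc (wavelet_integrand psi alpha f b a t))%:E <=
  (Num.sqrt (absp (a : n.-tuple R)))%:E *
  (\int[leb]_u (Normc.normc (psi u))%:E) * C.
Proof.
move=> a0 mD mf mpsi fC.
pose F t := (Normc.normc (f t))%:E; pose G t := (Normc.normc (psi t))%:E.
have F0 t : 0 <= F t by rewrite lee_fin normc_ge0.
have G0 t : 0 <= G t by rewrite lee_fin normc_ge0.
have mF : measurable_fun setT F.
  by apply/measurable_EFinP; exact: measurable_normc.
have mG : measurable_fun setT G.
  by apply/measurable_EFinP; exact: measurable_normc.
have ap : (0 < Num.sqrt (absp (a : n.-tuple R)))%R.
  by rewrite sqrtr_gt0 lt_neqAle eq_sym a0 normr_ge0.
have mFG : measurable_fun setT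
    (fun p : T * T => F p.2 * G (tdiv (tsub p.2 p.1) a)).
  apply: emeasurable_funM; first exact: (measurableT_comp mF measurable_snd).
  apply: (measurableT_comp mG).
  exact: (measurable_tdiv_tsub _ measurable_snd measurable_fst).
have mH : measurable_fun setT
    (fun b => \int[leb]_t (F t * G (tdiv (tsub t b) a))).
  apply: (@measurable_fun_fubini_tonelli_F _ _ _ _ R leb _ mFG) => p.
  exact: mule_ge0.
have mK : measurable_fun setT (fun u => \int[leb]_(b in D) F (tshift a b u)).
  have mFD : measurable_fun setT
      (fun p : T * T => F (tshift a p.2 p.1) * (\1_D p.2)%:E).
    apply: emeasurable_funM.
      apply: (measurableT_comp mF).
      exact: (measurableT_comp (measurable_tshift a)
        (measurable_fun_pair measurable_snd measurable_fst)).
    apply/measurable_EFinP.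
    by apply: (measurableT_comp _ measurable_snd); exact: measurable_indic.
  have FD0 p : 0 <= (fun p : T * T => F (tshift a p.2 p.1) * (\1_D p.2)%:E) p.
    by rewrite /= mule_ge0.
  have := @measurable_fun_fubini_tonelli_F _ _ _ _ R leb _ mFD FD0.
  congr (measurable_fun _ _); apply/funext => u.
  by rewrite [in RHS]integral_mkcond epatch_indic.
have -> : \int[leb]_(b in D) \int[leb]_t
      (Normc.normc (wavelet_integrand psi alpha f b a t))%:E =
    (Num.sqrt (absp (a : n.-tuple R)))^-1%:E *
    \int[leb]_(b in D) \int[leb]_t (F t * G (tdiv (tsub t b) a)).
  rewrite -(ge0_integralZl leb mD (measurable_funTS mH)); last 2 first.
  - by move=> b _; apply: integral_ge0 => t _; exact: mule_ge0.
  - by rewrite lee_fin invr_ge0 ltW.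
  apply: eq_integral => b _.
  rewrite -(ge0_integralZl leb measurableT
    (measurableT_comp mFG (pair1_measurable b))); last 2 first.
  - by move=> t _; exact: mule_ge0.
  - by rewrite lee_fin invr_ge0 ltW.
  by apply: eq_integral => t _; rewrite normc_wavelet_integrand EFinM EFinM.
rewrite dilated_convolution_integral// muleA -EFinM.
have -> : ((Num.sqrt (absp (a : n.-tuple R)))^-1 * absp (a : n.-tuple R) =
    Num.sqrt (absp (a : n.-tuple R)))%R.
  rewrite -{2}(sqr_sqrtr (normr_ge0 _ : 0 <= absp (a : n.-tuple R))%R) expr2.
  by rewrite mulKf// gt_eqF.
rewrite -muleA; apply: lee_wpmul2l; first by rewrite lee_fin ltW.
(* The point a is an arbitrary choice of u here. *)
have C0 : 0 <= C.
  apply: le_trans (fC a).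
  by apply: integral_ge0 => b _; rewrite lee_fin normc_ge0.
rewrite -(ge0_integralZr leb measurableT mG (fun u _ => G0 u) C0).
apply: ge0_le_integral => //.
- by move=> u _; apply: mule_ge0 => //; apply: integral_ge0.
- exact: emeasurable_funM.
- by apply: emeasurable_funM => //; exact: measurable_cst.
- by move=> u _; apply: lee_wpmul2l; [exact: G0|exact: fC].
Qed.
End wavelet_borel.

(** * The wavelet transform of Lebesgue-measurable functions *)

Section wavelet_transform_estimate.
Local Open Scope ereal_scope.
Context (R : realType) (n : nat).
Local Notation T := (n.-tuple (measurableTypeR R)).
Local Notation leb := (borel_lebesgue R n).
Local Notation mu := (@lebesgueRn R n).
Implicit Types (f g psi : Rn R n -> R[i]) (D N : set T).

Lemma ae_notin_borel N : measurable N -> leb N = 0 ->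
  {ae mu, forall t : Rn R n, ~ N t}.
Proof.
move=> mN N0; exists (N : set (Rn R n)); split.
- exact: measurable_Rn.
- by rewrite lebesgueRnE.
- by move=> t /= /contrapT.
Qed.

Lemma ae_notin_affine (a b : n.-tuple R) N : absp a != 0%R ->
  measurable N -> leb N = 0 ->
  {ae mu, forall t : Rn R n, ~ N (tdiv (tsub t b) a)}.
Proof.
move=> a0 mN N0.
have mphi : measurable_fun setT (fun t : T => tdiv (tsub t b) a : T).
  by apply: measurable_tdiv_tsub; [exact: measurable_id|exact: measurable_cst].
apply: (@ae_notin_borel [set t | N (tdiv (tsub t b) a)]).
  by rewrite -[X in measurable X]setTI; exact: mphi.
have mN1 : measurable_fun setT (fun t : T => (\1_N t)%:E : \bar R).
  by apply/measurable_EFinP; exact: measurable_indic.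
have N1_ge0 (t : T) : 0 <= (\1_N t)%:E :> \bar R by rewrite lee_fin.
have mphiN : measurable [set t : T | N (tdiv (tsub t b) a)].
  by rewrite -[X in measurable X]setTI; exact: mphi.
have iN0 : \int[leb]_t (\1_N t)%:E = 0 by rewrite integral_indic// setIT.
have := ge0_integral_borel_lebesgue_affine b a0 mN1 N1_ge0.
by rewrite iN0 mule0 integral_indic// setIT.
Qed.

Lemma ae_eq_integral_normc f g D : cmeasurable f ->
    {ae mu, forall t, f t = g t} -> measurable D ->
  \int[mu]_(t in D) (Normc.normc (f t))%:E =
  \int[mu]_(t in D) (Normc.normc (g t))%:E.
Proof.
move=> mf fg mD; have mg := ae_eq_cmeasurable mf fg.
apply: ae_eq_integral.
- exact: measurable_Rn.
- by apply: measurable_funTS; apply/measurable_EFinP; exact: measurable_normc.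
- by apply: measurable_funTS; apply/measurable_EFinP; exact: measurable_normc.
- by apply: filterS fg => t -> _.
Qed.

(** The two integrands differ only where t lies in the null set of f or where
    (t - b) / a lies in that of psi; both sets are null for every b, not just
    for almost every b. *)
Lemma wavelet_representatives alpha psi f a : absp (a : n.-tuple R) != 0%R ->
    cmeasurable psi -> cmeasurable f ->
  exists psi' f' : T -> R[i], [/\
    complex_measurable psi', complex_measurable f',
    {ae mu, forall t : Rn R n, psi t = psi' t}, {ae mu, forall t, f t = f' t} &
    forall b, {ae mu, forall t, wavelet_integrand psi alpha f b a t =
                               wavelet_integrand psi' alpha f' b a t}].
Proof.
move=> a0 mpsi mf.
have [psi' [N [mpsi' mN N0 psiE]]] := cmeasurable_representative mpsi.
have [f' [M [mf' mM M0 fE]]] := cmeasurable_representative mf.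
have aeN := ae_notin_borel mN N0; have aeM := ae_notin_borel mM M0.
exists psi', f'; split => //.
- by apply: filterS aeN => t; exact: psiE.
- by apply: filterS aeM => t; exact: fE.
- move=> b.
  have aeNb := ae_notin_affine b a0 mN N0.
  apply: filterS2 aeNb aeM => t Nt Mt.
  by rewrite /wavelet_integrand /wavelet_atom fE// psiE.
Qed.

Section estimate.
Variables (alpha : R) (psi f : Rn R n -> R[i]) (a : Rn R n).
Hypotheses (a0 : absp (a : n.-tuple R) != 0%R) (mpsi : cmeasurable psi)
  (mf : cmeasurable f).

Lemma cmeasurable_wavelet_integrand b :
  cmeasurable (wavelet_integrand psi alpha f b a).
Proof.
have [psi' [f' [mpsi' mf' _ _ E]]] := wavelet_representatives alpha a0 mpsi mf.
have mI := measurable_wavelet_integrand alpha a mf' mpsi'.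
have mIb : complex_measurable
    (fun t : T => wavelet_integrand psi' alpha f' b a t : R[i]).
  exact: (complex_measurable_comp mI (pair1_measurable (b : T))).
apply: (ae_eq_cmeasurable (cmeasurable_borel mIb)).
by apply: filterS (E b) => t ->.
Qed.

Lemma cmeasurable_wavelet_transform :
  cmeasurable (fun b => wavelet_transform psi alpha f b a).
Proof.
have [psi' [f' [mpsi' mf' _ _ E]]] := wavelet_representatives alpha a0 mpsi mf.
have -> : (fun b => wavelet_transform psi alpha f b a) =
    (fun b => wavelet_transform psi' alpha f' b a).
  apply/funext => b.
  exact: (ae_eq_cintegral (cmeasurable_wavelet_integrand b) (E b)).
apply: cmeasurable_borel.
exact: (cmeasurable_cintegral (measurable_wavelet_integrand alpha a mf' mpsi')).
Qed.

(** The family D' u of translates of D covers the two uses: D a ball, which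
    gives the Morrey bound, and D the whole space, which gives the L^1 bound. *)
Lemma integral_normc_wavelet_integrand_le D (D' : T -> set T) (C : \bar R) :
    measurable D -> (forall u, measurable (D' u)) ->
    (forall u b, D b <-> D' u (tshift a b u)) ->
    (forall u, \int[mu]_(s in D' u) (Normc.normc (f s))%:E <= C) ->
  measurable_fun setT (fun b : T =>
    \int[mu]_t (Normc.normc (wavelet_integrand psi alpha f b a t))%:E) /\
  \int[mu]_(b in D) \int[mu]_t
    (Normc.normc (wavelet_integrand psi alpha f b a t))%:E <=
  (Num.sqrt (absp (a : n.-tuple R)))%:E * cLnorm 1 psi * C.
Proof.
move=> mD mD' DD' fC.
have [psi' [f' [mpsi' mf' psiE fE E]]] :=
  wavelet_representatives alpha a0 mpsi mf.
have mI := measurable_wavelet_integrand alpha a mf' mpsi'.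
have mIE : measurable_fun setT (fun p : T * T =>
    (Normc.normc (wavelet_integrand psi' alpha f' p.1 a p.2))%:E).
  by apply/measurable_EFinP; exact: measurable_normc.
have IE : (fun b : T =>
    \int[mu]_t (Normc.normc (wavelet_integrand psi alpha f b a t))%:E) =
    (fun b : T =>
      \int[leb]_t (Normc.normc (wavelet_integrand psi' alpha f' b a t))%:E).
  apply/funext => b.
  have mIb := cmeasurable_wavelet_integrand b.
  rewrite (ae_eq_integral_normc mIb (E b) measurableT).
  apply: ge0_integral_lebesgueRn => //.
  - exact: (measurableT_comp mIE (pair1_measurable b)).
  - by move=> t; rewrite lee_fin normc_ge0.
have mIb : measurable_fun setT (fun b : T =>
    \int[leb]_t (Normc.normc (wavelet_integrand psi' alpha f' b a t))%:E).
  apply: (@measurable_fun_fubini_tonelli_F _ _ _ _ R leb _ mIE) => p.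
  by rewrite lee_fin normc_ge0.
have mn (g : T -> R[i]) : complex_measurable g ->
    measurable_fun setT (fun t : T => (Normc.normc (g t))%:E).
  by move=> mg; apply/measurable_EFinP; exact: measurable_normc.
split; first by rewrite IE.
rewrite IE ge0_integral_lebesgueRn//; last first.
  by move=> b; apply: integral_ge0 => t _; rewrite lee_fin normc_ge0.
have -> : cLnorm 1 psi = \int[leb]_u (Normc.normc (psi' u))%:E.
  rewrite cLnorm1E (ae_eq_integral_normc mpsi psiE measurableT).
  apply: ge0_integral_lebesgueRn => //; first exact: mn.
  by move=> t; rewrite lee_fin normc_ge0.
apply: integral_wavelet_integrand_le => // u.
rewrite (@ge0_integral_tshift _ _ D (D' u)
  (fun t => (Normc.normc (f' t))%:E))//; last 2 first.
- exact: mn.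
- by move=> t; rewrite lee_fin normc_ge0.
rewrite -ge0_integral_lebesgueRn//; last 2 first.
- exact: mn.
- by move=> t; rewrite lee_fin normc_ge0.
by rewrite -(ae_eq_integral_normc mf fE (mD' u)).
Qed.

Lemma integral_normc_wavelet_transform_le D (D' : T -> set T) (C : \bar R) :
    measurable D -> (forall u, measurable (D' u)) ->
    (forall u b, D b <-> D' u (tshift a b u)) ->
    (forall u, \int[mu]_(s in D' u) (Normc.normc (f s))%:E <= C) ->
  \int[mu]_(b in D) (Normc.normc (wavelet_transform psi alpha f b a))%:E <=
  (Num.sqrt (absp (a : n.-tuple R)))%:E * cLnorm 1 psi * C.
Proof.
move=> mD mD' DD' fC.
have [mI] := integral_normc_wavelet_integrand_le mD mD' DD' fC.
apply: le_trans; apply: ge0_le_integral.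
- exact: measurable_Rn.
- by move=> b _; rewrite lee_fin normc_ge0.
- apply: measurable_funTS; apply/measurable_EFinP.
  exact: (measurable_normc cmeasurable_wavelet_transform).
- by apply: measurable_funTS; exact: measurable_fun_Rn.
- by move=> b _; exact: (normc_cintegral_le (cmeasurable_wavelet_integrand b)).
Qed.

(** The integral over b of the integrals of the moduli is finite, so almost all
    of these integrals are. *)
Lemma ae_cintegrable_wavelet_integrand :
    cLnorm 1 psi < +oo -> cLnorm 1 f < +oo ->
  {ae mu, forall b, cintegrable (wavelet_integrand psi alpha f b a)}.
Proof.
move=> psioo foo.
have [||||mI Ile] :=
  @integral_normc_wavelet_integrand_le setT (fun=> setT) (cLnorm 1 f).
- exact: measurableT.
- by move=> _; exact: measurableT.
- by [].
- by move=> _; rewrite cLnorm1E.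
set I := (fun b : T => _) in mI.
have I0 (b : T) : 0 <= I b.
  by apply: integral_ge0 => t _; rewrite lee_fin normc_ge0.
have Ii : mu.-integrable setT (I : Rn R n -> \bar R).
  apply/integrableP; split; first exact: measurable_fun_Rn.
  under eq_integral => b _ do rewrite (gee0_abs (I0 b)).
  apply: le_lt_trans Ile _.
  have psi_fin : cLnorm 1 psi \is a fin_num by rewrite ge0_fin_numE ?Lnorm_ge0.
  apply: lte_mul_pinfty => //; last by rewrite fin_numM.
  by apply: mule_ge0; [rewrite lee_fin sqrtr_ge0|exact: Lnorm_ge0].
have Ifin := integrable_ae measurableT Ii.
apply: filterS Ifin => b /(_ Logic.I); rewrite ge0_fin_numE//.
exact: (cintegrable_normc (cmeasurable_wavelet_integrand b)).
Qed.

End estimate.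
End wavelet_transform_estimate.

(** * Morrey bounds *)

Section morrey_estimate.
Local Open Scope ereal_scope.
Context (R : realType) (n : nat).
Local Notation mu := (@lebesgueRn R n).
Implicit Types (f psi : Rn R n -> R[i]).

Lemma morrey_norm_ball_le (nu r : R) f (x : Rn R n) : (0 < r)%R ->
  \int[mu]_(t in eball x r) (Normc.normc (f t))%:E <=
  (r `^ nu)%:E * morrey_norm nu f.
Proof.
move=> r0; rewrite -lee_pdivrMl ?powR_gt0//.
by apply: ereal_sup_ubound; exists x, r.
Qed.

Lemma morrey_norm_le (nu : R) f (M : \bar R) :
    (forall (x : Rn R n) (r : R), (0 < r)%R ->
      \int[mu]_(t in eball x r) (Normc.normc (f t))%:E <= (r `^ nu)%:E * M) ->
  morrey_norm nu f <= M.
Proof.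
move=> fM; apply: ge_ereal_sup => _ [x [r [r0 ->]]].
by rewrite lee_pdivrMl ?powR_gt0// fM.
Qed.

Lemma morrey_norm_wavelet_transform_le (nu alpha : R) psi f (a : Rn R n) :
    absp (a : n.-tuple R) != 0%R -> cmeasurable psi -> cmeasurable f ->
  morrey_norm nu (fun b => wavelet_transform psi alpha f b a) <=
  (Num.sqrt (absp (a : n.-tuple R)))%:E * cLnorm 1 psi * morrey_norm nu f.
Proof.
move=> a0 mpsi mf; apply: morrey_norm_le => x r r0.
rewrite muleCA.
apply: (@integral_normc_wavelet_transform_le _ _ alpha psi f a a0 mpsi mf
  (eball x r) (fun u => eball (tshift a x u) r)).
- exact: measurable_eball.
- by move=> u; exact: measurable_eball.
- by move=> u b; exact: eball_tshift.
- by move=> u; exact: morrey_norm_ball_le.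
Qed.

Lemma cLnorm1_wavelet_transform_le (alpha : R) psi f (a : Rn R n) :
    absp (a : n.-tuple R) != 0%R -> cmeasurable psi -> cmeasurable f ->
  cLnorm 1 (fun b => wavelet_transform psi alpha f b a) <=
  (Num.sqrt (absp (a : n.-tuple R)))%:E * cLnorm 1 psi * cLnorm 1 f.
Proof.
move=> a0 mpsi mf; rewrite cLnorm1E.
apply: (@integral_normc_wavelet_transform_le _ _ alpha psi f a a0 mpsi mf
  setT (fun=> setT)).
- exact: measurableT.
- by move=> _; exact: measurableT.
- by [].
- by move=> _; rewrite cLnorm1E.
Qed.

End morrey_estimate.

Theorem theorem5p1 (R : realType) (n : nat) (nu alpha : R)
    (psi : Rn R n -> R[i]) (a : Rn R n)
    (n_ge1 : (1 <= n)%N) (nu_ge0 : 0 <= nu)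
    (alphaNpi : forall k : int, alpha != k%:~R * pi)
    (psi_wavelet : is_wavelet alpha psi) (psi_L1 : cLfun 1%E psi)
    (a_neq0 : Rn0 a) :
  [/\ forall f : Rn R n -> R[i], morrey nu f ->
        {ae @lebesgueRn R n, forall b : Rn R n,
          cintegrable (wavelet_integrand psi alpha f b a)},
      bounded_morrey_operator nu
        (fun f b => wavelet_transform psi alpha f b a)
    & forall f : Rn R n -> R[i], morrey nu f ->
        (morrey_norm nu (fun b => wavelet_transform psi alpha f b a)
         <= (Num.sqrt (absp a))%:E * cLnorm 1 psi * morrey_norm nu f)%E].
Proof.
have [mpsi psioo] := psi_L1.
have psi_fin : cLnorm 1 psi \is a fin_num by rewrite ge0_fin_numE ?Lnorm_ge0.
pose S := (Num.sqrt (absp a) * fine (cLnorm 1 psi))%:E.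
have SE : S = ((Num.sqrt (absp a))%:E * cLnorm 1 psi)%E.
  by rewrite /S EFinM fineK.
have S_ltoo (x : \bar R) : (x < +oo -> S * x < +oo)%E.
  apply: lte_mul_pinfty => //.
  by rewrite lee_fin mulr_ge0 ?sqrtr_ge0 ?fine_ge0 ?Lnorm_ge0.
have aeI f : morrey nu f -> {ae @lebesgueRn R n, forall b : Rn R n,
    cintegrable (wavelet_integrand psi alpha f b a)}.
  by move=> [[mf foo] _]; exact: ae_cintegrable_wavelet_integrand.
have normT f : morrey nu f ->
    (morrey_norm nu (fun b => wavelet_transform psi alpha f b a)
      <= (Num.sqrt (absp a))%:E * cLnorm 1 psi * morrey_norm nu f)%E.
  by move=> [[mf _] _]; exact: morrey_norm_wavelet_transform_le.
split; [exact: aeI|split|exact: normT].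
- move=> f fM; have [[mf foo] fMoo] := fM; split; [split|].
  + exact: cmeasurable_wavelet_transform.
  + apply: le_lt_trans (cLnorm1_wavelet_transform_le alpha a_neq0 mpsi mf) _.
    by rewrite -SE; exact: S_ltoo.
  + by apply: le_lt_trans (normT f fM) _; rewrite -SE; exact: S_ltoo.
- move=> f g [[mf _] _] _ fg; apply: aeW => b.
  apply: ae_eq_cintegral; first exact: cmeasurable_wavelet_integrand.
  by apply: filterS fg => t ft; rewrite /wavelet_integrand ft.
- move=> c f g fM gM; have fI := aeI f fM; have gI := aeI g gM.
  apply: filterS2 fI gI => b fIb gIb.
  rewrite -cintegral_linear//; congr cintegral.
  by apply/funext => t; rewrite /wavelet_integrand mulrDl mulrA.
- exists (Num.sqrt (absp a) * fine (cLnorm 1 psi)) => f fM.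
  by rewrite -/S SE; exact: normT.
Qed.
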